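(* Let $C$ be a finite skew brace with $(C,+)=A$ and $(C,\circ)=R$, let $T$ be a non-trivial finite abelian group with underlying set $\Omega$, let $\chi:R\to T$ be a surjective homomorphism, and let $B=\mathsf{K}_T(C,\chi)$ be the kernel--wreath skew brace, with $(B,+)=A^\Omega$ and $(B,\circ)\cong G=\ker\varepsilon\le W=R^\Omega\rtimes T$. If $R$ is solvable, then $G$ is solvable.
   Context: A skew brace is a triple $(B,+,\circ)$ such that $(B,+)$ and $(B,\circ)$ are groups (neither assumed abelian) on the same set and $a\circ(b+c)=a\circ b-a+a\circ c$ for all $a,b,c\in B$. Its lambda map is the homomorphism $\lambda^B:(B,\circ)\to\mathrm{Aut}(B,+)$, $\lambda^B_a(b)=-a+a\circ b$. The kernel--wreath skew brace $\mathsf{K}_T(C,\chi)$: let $\pi:R\to A$ be the identity map on the underlying set of $C$. The group $T$ acts on $R^\Omega$ by ${}^u(r_x)_{x\in\Omega}=(r_{u^{-1}x})_{x\in\Omega}$; let $W=R^\Omega\rtimes T$, with $(r,u)(s,v)=(r\,{}^us,uv)$. The group $W$ acts on $A^\Omega$ by $(r,u)\cdot(a_x)_x=\big(\pi(r_x)+\lambda^C_{r_x}(a_{u^{-1}x})\big)_x$. Let $\varepsilon:W\to T$ be the homomorphism $\varepsilon((r_x)_x,u)=\big(\prod_{x\in\Omega}\chi(r_x)\big)u$ and $G=\ker\varepsilon$. The group $G$ acts regularly on $A^\Omega$, and $\Pi:G\to A^\Omega$, $\Pi((r_x)_x,u)=(\pi(r_x))_x$, is a bijection. Then $\mathsf{K}_T(C,\chi)$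 is the skew brace with underlying set $A^\Omega$, whose addition is that of the direct product $A^\Omega$ and whose multiplication is the group structure of $G$ transported along $\Pi$. *)

(* Defs.v *)
From HB Require Import structures.
From mathcomp Require Import all_boot all_fingroup all_solvable.

Set Implicit Arguments.
Unset Strict Implicit.
Unset Printing Implicit Defensive.

Import GroupScope.
Local Open Scope group_scope.

Declare Scope brace_scope.
Delimit Scope brace_scope with brace.

(* The circle operation of a skew brace is its group law x * y (group_scope).
   The addition is a second, possibly noncommutative, group law; the library's
   additive structures with axioms are all commutative. *)
HB.mixin Record isSkewBrace B of monoid.Group B := {
  sbadd : B -> B -> B;
  sbzero : B;
  sbopp : B -> B;
  sbaddA : associative sbadd;
  sbadd0 : left_id sbzero sbadd;
  sbaddN : left_inverse sbzero sbopp sbadd;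
  sbmulD : forall a b c : B,
    a * sbadd b c = sbadd (sbadd (a * b) (sbopp a)) (a * c)
}.

#[short(type="skewBraceType")]
HB.structure Definition SkewBrace := {B of isSkewBrace B & monoid.Group B}.

Notation "x + y" := (sbadd x y) : brace_scope.
Notation "- x" := (sbopp x) : brace_scope.
Notation "0" := sbzero : brace_scope.
Notation "x - y" := (sbadd x (sbopp y)) : brace_scope.

#[short(type="finSkewBraceType")]
HB.structure Definition FinSkewBrace := {B of SkewBrace B & Finite B}.

(* The library's external semidirect product uses right actions and puts the
   acting group first; here it acts on the left and comes second. *)
Section Wreath.

Variables R T : finGroupType.

Definition shift (u : T) (r : {ffun T -> R}) : {ffun T -> R} :=
  [ffun x => r (u^-1 * x)].

Definition wreath : Type := ({ffun T -> R} * T)%type.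

HB.instance Definition _ := Finite.on wreath.

Definition wreath_mul (p q : wreath) : wreath :=
  (p.1 * shift p.2 q.1, p.2 * q.2).
Definition wreath_one : wreath := (1, 1).
Definition wreath_inv (p : wreath) : wreath := (shift p.2^-1 p.1^-1, p.2^-1).

Fact wreath_mulA : associative wreath_mul.
Proof.
move=> [r u] [s v] [t w]; congr (_, _); rewrite /= ?mulgA //.
by apply/ffunP=> x; rewrite !ffunE invMg !mulgA.
Qed.

Fact wreath_mul1 : left_id wreath_one wreath_mul.
Proof.
move=> [r u]; congr (_, _); rewrite /= ?mul1g //.
by apply/ffunP=> x; rewrite !ffunE invg1 !mul1g.
Qed.

Fact wreath_mulV : left_inverse wreath_one wreath_inv wreath_mul.
Proof.
move=> [r u]; congr (_, _); rewrite /= ?mulVg //.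
by apply/ffunP=> x; rewrite !ffunE mulVg.
Qed.

HB.instance Definition _ :=
  Finite_isGroup.Build wreath wreath_mulA wreath_mul1 wreath_mulV.

End Wreath.

Section KernelWreath.

Variables (C : finSkewBraceType) (T : finGroupType).
Hypothesis cTT : abelian [set: T].
Variable chi : {morphism [set: C] >-> T}.

Local Notation W := (wreath C T).

(* The order of the factors is irrelevant as T is abelian. *)
Definition wreath_eps (w : W) : T := (\prod_(x : T) chi (w.1 x)) * w.2.

Fact kwreath_mulTC (x y : T) : x * y = y * x.
Proof. by apply: (centsP cTT); rewrite inE. Qed.

Fact kwreath_prodM (f g : T -> T) :
  \prod_(x : T) (f x * g x) = (\prod_(x : T) f x) * \prod_(x : T) g x.
Proof.
elim/big_rec3: _ => [|x a b c _ ->]; first by rewrite mulg1.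
by rewrite !mulgA; congr (_ * _); rewrite -!mulgA; congr (_ * _);
   apply: kwreath_mulTC.
Qed.

Fact kwreath_prod_shift (u : T) (f : T -> T) :
  \prod_(x : T) f (u * x) = \prod_(x : T) f x.
Proof.
pose cop (x y : T) := x * y.
have copA : associative cop by exact: mulgA.
pose L := Monoid.isComLaw.Build T 1 cop copA kwreath_mulTC (@mul1g T).
pose comT : Monoid.com_law 1 := HB.pack_for (Monoid.com_law 1) cop L.
have := @reindex_inj T comT 1 T (fun x => u * x) xpredT f (mulgI u).
by move=> ->.
Qed.

Fact wreath_epsM : {in [set: W] &, {morph wreath_eps : v w / v * w}}.
Proof.
move=> [r u] [s v] _ _; rewrite /wreath_eps /=.
have -> : \prod_(x : T) chi ((r * shift u s) x) =
          (\prod_(x : T) chi (r x)) * \prod_(x : T) chi (s x).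
  rewrite -(kwreath_prod_shift u^-1 (fun x => chi (s x))) -kwreath_prodM.
  by apply: eq_bigr => x _; rewrite !ffunE morphM ?inE.
rewrite -!mulgA; congr (_ * _); rewrite !mulgA; congr (_ * _).
exact: kwreath_mulTC.
Qed.

Definition wreath_eps_morphism : {morphism [set: W] >-> T} :=
  Morphism wreath_epsM.

Definition kwreath_group : {group W} := 'ker wreath_eps_morphism.

Definition kwreath_Pi (w : W) : {ffun T -> C} := w.1.

Definition kwreath_Pi_inv (a : {ffun T -> C}) : W :=
  (a, (\prod_(x : T) chi (a x))^-1).

Lemma kwreath_groupE w : (w \in kwreath_group) = (wreath_eps w == 1).
Proof. by apply/kerP/eqP; rewrite ?inE. Qed.

Lemma kwreath_Pi_inv_in a : kwreath_Pi_inv a \in kwreath_group.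
Proof. by rewrite kwreath_groupE /wreath_eps /= mulgV. Qed.

Lemma kwreath_Pi_invK : cancel kwreath_Pi_inv kwreath_Pi.
Proof. by []. Qed.

Lemma kwreath_PiK : {in kwreath_group, cancel kwreath_Pi kwreath_Pi_inv}.
Proof.
move=> [r u]; rewrite kwreath_groupE /wreath_eps /= => /eqP ru1.
congr (_, _); apply: (mulgI (\prod_(x : T) chi (r x))).
by rewrite mulgV [RHS]ru1.
Qed.

End KernelWreath.

(* K_T(C, chi); the proof cTT is a parameter of the carrier because the group
   structure below depends on it. *)
Definition kwreath (C : finSkewBraceType) (T : finGroupType)
  (cTT : abelian [set: T]) (chi : {morphism [set: C] >-> T}) : Type :=
  {ffun T -> C}.

Section KernelWreathBrace.

Variables (C : finSkewBraceType) (T : finGroupType).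
Variables (cTT : abelian [set: T]) (chi : {morphism [set: C] >-> T}).

Local Notation K := (kwreath cTT chi).
Local Notation G := (kwreath_group cTT chi).
Local Notation Pi := (@kwreath_Pi C T).
Local Notation Pi_inv := (kwreath_Pi_inv chi).

HB.instance Definition _ := Finite.on K.

Definition kwreath_add (a b : K) : K := [ffun x => (a x + b x)%brace].
Definition kwreath_zero : K := [ffun => 0%brace].
Definition kwreath_opp (a : K) : K := [ffun x => (- a x)%brace].

Definition kwreath_mul (a b : K) : K := Pi (Pi_inv a * Pi_inv b).
Definition kwreath_one : K := Pi 1.
Definition kwreath_inv (a : K) : K := Pi (Pi_inv a)^-1.

Let Pi_invM (a b : K) : Pi_inv (kwreath_mul a b) = Pi_inv a * Pi_inv b.
Proof. by apply: (kwreath_PiK (cTT := cTT)); rewrite groupM ?kwreath_Pi_inv_in. Qed.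

Let Pi_inv1 : Pi_inv kwreath_one = 1.
Proof. by apply: (kwreath_PiK (cTT := cTT)); rewrite group1. Qed.

Let Pi_invV (a : K) : Pi_inv (kwreath_inv a) = (Pi_inv a)^-1.
Proof. by apply: (kwreath_PiK (cTT := cTT)); rewrite groupV kwreath_Pi_inv_in. Qed.

Let Pi_inv_inj : injective Pi_inv := can_inj (kwreath_Pi_invK chi).

Fact kwreath_mulA : associative kwreath_mul.
Proof. by move=> a b c; apply: Pi_inv_inj; rewrite !Pi_invM mulgA. Qed.

Fact kwreath_mul1 : left_id kwreath_one kwreath_mul.
Proof. by move=> a; apply: Pi_inv_inj; rewrite Pi_invM Pi_inv1 mul1g. Qed.

Fact kwreath_mulV : left_inverse kwreath_one kwreath_inv kwreath_mul.
Proof.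
by move=> a; apply: Pi_inv_inj; rewrite Pi_invM Pi_invV Pi_inv1 mulVg.
Qed.

HB.instance Definition _ :=
  Finite_isGroup.Build K kwreath_mulA kwreath_mul1 kwreath_mulV.

Fact kwreath_addA : associative kwreath_add.
Proof. by move=> a b c; apply/ffunP=> x; rewrite !ffunE sbaddA. Qed.

Fact kwreath_add0 : left_id kwreath_zero kwreath_add.
Proof. by move=> a; apply/ffunP=> x; rewrite !ffunE sbadd0. Qed.

Fact kwreath_addN : left_inverse kwreath_zero kwreath_opp kwreath_add.
Proof. by move=> a; apply/ffunP=> x; rewrite !ffunE sbaddN. Qed.

Fact kwreath_mulD (a b c : K) :
  kwreath_mul a (kwreath_add b c) =
  kwreath_add (kwreath_add (kwreath_mul a b) (kwreath_opp a)) (kwreath_mul a c).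
Proof. by apply/ffunP=> x; rewrite !ffunE sbmulD. Qed.

HB.instance Definition _ :=
  isSkewBrace.Build K kwreath_addA kwreath_add0 kwreath_addN kwreath_mulD.

Fact kwreath_Pi_invM :
  {in [set: K] &, {morph (fun a : K => Pi_inv a) : a b / a * b}}.
Proof. by move=> a b _ _; apply: Pi_invM. Qed.

Lemma kwreath_isog : [set: K] \isog G.
Proof.
apply/isogP; exists (Morphism kwreath_Pi_invM).
  by apply/injmP=> a b _ _; apply: Pi_inv_inj.
apply/setP=> w; apply/morphimP/idP=> [[a _ _ ->]|Gw] /=.
  exact: kwreath_Pi_inv_in.
by exists (Pi w); rewrite ?inE //= (kwreath_PiK Gw).
Qed.

End KernelWreathBrace.

(* Main.v *)
(* The projection of the wreath product W onto T has kernel R^Omega. Each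
   coordinate on this kernel is a homomorphism to R, so its n-th derived
   subgroup is trivial once that of R is; hence W is an extension of a solvable
   group by a solvable group, and G is a subgroup of W. *)

Require Import Defs.
From mathcomp Require Import all_boot all_fingroup all_solvable.

Local Open Scope group_scope.

Section WreathSolvable.

Variables R T : finGroupType.

Local Notation W := (wreath R T).

Definition wreath_top (w : W) : T := w.2.

Fact wreath_topM : {in [set: W] &, {morph wreath_top : v w / v * w}}.
Proof. by []. Qed.

Canonical wreath_top_morphism : {morphism [set: W] >-> T} :=
  Morphism wreath_topM.

Definition wreath_base : {group W} := 'ker wreath_top_morphism.

Lemma wreath_baseP (w : W) : reflect (w.2 = 1) (w \in wreath_base).
Proof. by apply: (iffP (kerP _ _)); rewrite ?inE. Qed.

Definition wreath_coord (x : T) (w : W) : R := w.1 x.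

(** In [W] the [T]-component of the left factor shifts the coordinates of the right one; on the base
    this shift is by 1, so coordinates multiply pointwise. *)
Fact wreath_coordM x : {in wreath_base &, {morph wreath_coord x : v w / v * w}}.
Proof.
move=> v w /wreath_baseP v2 _.
by rewrite /wreath_coord !ffunE v2 invg1 mul1g.
Qed.

Canonical wreath_coord_morphism x : {morphism wreath_base >-> R} :=
  Morphism (wreath_coordM x).

Lemma wreath_base_sol : solvable [set: R] -> solvable wreath_base.
Proof.
move=> /derivedP[n Rn1]; apply/derivedP; exists n; apply/trivgP/subsetP=> w dw.
have Nw : w \in wreath_base by apply: (subsetP (der_sub n _)).
have w1 x : w.1 x = 1.
  (* Morphisms carry derived subgroups to derived subgroups, so the coordinate of [w] at [x] lies in
     the trivial [n]-th derived subgroup of [R]. *)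
  have fN : (wreath_coord_morphism x @* wreath_base)^`(n) \subset [1 R].
    by rewrite -Rn1 dergS ?subsetT.
  apply/set1P/(subsetP fN); rewrite -morphim_der //.
  exact: (mem_morphim (wreath_coord_morphism x) Nw dw).
(* The coordinates jointly separate the elements of the base, whose [T]-component is 1. *)
apply/set1P; case: w {dw} Nw w1 => r u /wreath_baseP /= -> r1.
by congr (_, _); apply/ffunP=> x; rewrite r1 ffunE.
Qed.

Lemma wreath_sol :
  solvable [set: R] -> solvable [set: T] -> solvable [set: W].
Proof.
move=> solR solT; rewrite (series_sol (ker_normal wreath_top_morphism)).
rewrite wreath_base_sol //=.
(* The quotient by the base is isomorphic to the image of the projection, a subgroup of [T]. *)
rewrite (isog_sol (first_isog wreath_top_morphism)).
exact: solvableS (subsetT _) solT.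
Qed.

End WreathSolvable.

Theorem proposition3p3 (C : finSkewBraceType) (T : finGroupType)
    (cTT : abelian [set: T]) (ntT : [set: T] != 1)
    (chi : {morphism [set: C] >-> T}) (chi_surj : chi @* [set: C] = [set: T]) :
  let B : finSkewBraceType := kwreath cTT chi in
  solvable [set: C] -> solvable (kwreath_group cTT chi).
Proof.
move=> B solC; apply: solvableS (subsetT _) _.
exact: wreath_sol solC (abelian_sol cTT).
Qed.
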